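(* Let $r\in\mathbb{N}$ and let $G=(g_1,\ldots,g_r)$ be any system of polynomials with integer coefficients. Then the function $(m_1,\ldots,m_r)\mapsto R_G(m_1,\ldots,m_r)$ is multiplicative. In particular, for any polynomial $g$ with integer coefficients, the function of one variable $$R_g(m)=\sum_{\substack{k=1\\ \gcd(k,m)=1}}^m c_m(g(k))=\phi(m)\sum_{d\mid m}\frac{d\mu(m/d)}{\phi(d)}\eta_g(d)$$ is multiplicative.
   Context: For $n\in\mathbb{N}$ and $k\in\mathbb{Z}$, $c_n(k)=\sum_{1\le j\le n,\ \gcd(j,n)=1}\exp(2\pi i jk/n)$ is the Ramanujan sum. $\mu$ is the Möbius function, $\phi$ Euler's totient. For $m_1,\ldots,m_r\in\mathbb{N}$ with $m=\operatorname{lcm}(m_1,\ldots,m_r)$, $R_G(m_1,\ldots,m_r)=\sum_{1\le k\le m,\ \gcd(k,m)=1}c_{m_1}(g_1(k))\cdots c_{m_r}(g_r(k))$. For $d\in\mathbb{N}$, $\eta_g(d)$ is the number of residues $x$ modulo $d$ with $g(x)\equiv 0\pmod d$ and $\gcd(x,d)=1$. A function $f:\mathbb{N}^r\to\mathbb{C}$ is multiplicative if it is not identically zero and $f(m_1n_1,\ldots,m_rn_r)=f(m_1,\ldots,m_r)f(n_1,\ldots,n_r)$ whenever $\gcd(m_1\cdots m_r,n_1\cdots n_r)=1$. *)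

(* Defs.v *)
From mathcomp Require Export all_boot all_order all_algebra.
From mathcomp Require Export reals sequences trigo.
From mathcomp Require Export complex.

Set Implicit Arguments.
Unset Strict Implicit.
Unset Printing Implicit Defensive.

Import GRing.Theory Num.Theory.

Local Open Scope ring_scope.
Local Open Scope complex_scope.

Definition cexp (R : realType) (z : R[i]) : R[i] :=
  (expR (complex.Re z))%:C * (cos (complex.Im z) +i* sin (complex.Im z)).

Definition ramanujan_sum (R : realType) (n : nat) (k : int) : R[i] :=
  \sum_(1 <= j < n.+1 | coprime j n)
     cexp (2 * (pi : R)%:C * 'i * j%:R * k%:~R / n%:R).

(* Meaningful for n > 0 only (the value at n = 0 is junk). *)
Definition moebius (n : nat) : int :=
  if all (fun p => logn p n == 1%N) (primes n) then (-1) ^+ size (primes n)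
  else 0.

Definition lcm_tuple (r : nat) (m : 'I_r -> nat) : nat :=
  \big[lcmn/1%N]_(i < r) m i.

Definition R_sys (R : realType) (r : nat) (G : 'I_r -> {poly int})
    (m : 'I_r -> nat) : R[i] :=
  \sum_(1 <= k < (lcm_tuple m).+1 | coprime k (lcm_tuple m))
     \prod_(i < r) ramanujan_sum R (m i) (G i).[k%:Z].

(* The ordinals below d serve as representatives of the residues modulo d. *)
Definition eta (g : {poly int}) (d : nat) : nat :=
  #|[set x : 'I_d | (d%:Z %| g.[(x : nat)%:Z])%Z & coprime x d]|.

(* Arithmetic functions live on positive integers, so only positive arguments
   are constrained; in particular nonvanishing is required at a positive one. *)
Definition multiplicative_fun (R : realType) (r : nat)
    (f : ('I_r -> nat) -> R[i]) : Prop :=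
  (exists2 m : 'I_r -> nat, (forall i, (0 < m i)%N) & f m <> 0) /\
  (forall m n : 'I_r -> nat,
     (forall i, (0 < m i)%N) -> (forall i, (0 < n i)%N) ->
     coprime (\prod_(i < r) m i) (\prod_(i < r) n i) ->
     f (fun i => (m i * n i)%N) = f m * f n).

Definition multiplicative_fun1 (R : realType) (f : nat -> R[i]) : Prop :=
  multiplicative_fun (fun m : 'I_1 -> nat => f (m ord0)).

Definition R_one (R : realType) (g : {poly int}) (m : nat) : R[i] :=
  R_sys R (fun _ : 'I_1 => g) (fun _ => m).

(* Main.v *)
From mathcomp Require Import exp ring lra.
Require Import Defs.
Set Implicit Arguments.
Unset Strict Implicit.
Import GRing.Theory Num.Theory.
Local Open Scope ring_scope.
Local Open Scope complex_scope.

(** For coprime [m] and [n], writing the residues modulo [m * n] as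
    [n * a + m * b] splits [exp (2 i pi j k / (m n))] into a product, which gives
    [c_(m n) = c_m * c_n]. Since [c_m (g k)] depends on [k] modulo [m] only, the
    Chinese remainder theorem then factors the sum defining [R_G].

    For the closed formula, detecting [gcd (j, n) = 1] by the sum of [mu] over
    the common divisors yields [c_n (k) = \sum_(d | n, d | k) d mu (n / d)]; it
    remains to count the units [k] modulo [m] with [d | g k], and the reduction
    from units modulo [m] to units modulo [d] has fibres of constant size
    [phi m / phi d]. *)

(** * Sums of periodic functions *)

Lemma eqn_modMl_coprime u a b m :
  coprime u m -> ((u * a == u * b %[mod m]) = (a == b %[mod m]))%N.
Proof.
move=> co_um; wlog le_ba : a b / (b <= a)%N.
  by move=> th; case/orP: (leq_total b a) => /th // e; rewrite eq_sym e eq_sym.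
rewrite !eqn_mod_dvd ?leq_mul2l ?le_ba ?orbT // -mulnBr Gauss_dvdr //.
by rewrite coprime_sym.
Qed.

(** Stated by reduction rather than by adding [m], so that it rewrites directly; it holds for every
    [F] when [m = 0]. *)
Definition periodic_mod (V : Type) (m : nat) (F : nat -> V) :=
  forall k, F (k %% m)%N = F k.

Lemma periodic_mod_eq (V : Type) (m : nat) (F : nat -> V) a b :
  periodic_mod m F -> a = b %[mod m] -> F a = F b.
Proof. by move=> perF eqab; rewrite -(perF a) eqab perF. Qed.

(** The two ranges differ only in the representative of one class: [m] on the left, [0] on the
    right. *)
Lemma sum_shift_period (V : nmodType) (m : nat) (F : nat -> V) :
  (0 < m)%N -> periodic_mod m F ->
  \sum_(1 <= k < m.+1) F k = \sum_(k < m) F k.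
Proof.
case: m => // m _ perF; rewrite big_nat_recr //= big_add1 /= addrC.
by rewrite -perF modnn big_mkord big_ord_recl.
Qed.

(** Coprimality to [m] is itself periodic, so the filter can be absorbed into the summand. *)
Lemma sum_coprime_shift (V : nmodType) (m : nat) (F : nat -> V) :
  (0 < m)%N -> periodic_mod m F ->
  \sum_(1 <= k < m.+1 | coprime k m) F k = \sum_(k < m | coprime k m) F k.
Proof.
move=> m_gt0 perF; rewrite big_mkcond [RHS]big_mkcond /=.
pose H k := if coprime k m then F k else 0.
apply: (@sum_shift_period _ m H m_gt0) => k; rewrite /H.
by rewrite coprime_modl perF.
Qed.

Lemma sum_multiples (V : nmodType) (d q : nat) (F : nat -> V) :
  (0 < d)%N ->
  \sum_(j < (d * q)%N | (d %| j)%N) F j = \sum_(i < q) F (d * i)%N.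
Proof.
move=> d_gt0; rewrite -(big_mkord (fun j => d %| j)%N F).
rewrite -(big_mkord xpredT (fun i => F (d * i)%N)).
rewrite -[RHS](big_map (muln d) xpredT F) -[LHS]big_filter; apply: perm_big.
apply: uniq_perm.
- by rewrite filter_uniq ?iota_uniq.
- rewrite map_inj_uniq ?iota_uniq // => a b /eqP.
  by rewrite eqn_pmul2l // => /eqP.
move=> j; rewrite mem_filter mem_index_iota /=.
apply/andP/mapP => [[/dvdnP[c ->]] | [c]].
  rewrite mulnC ltn_pmul2l // => lt_cq; exists c => //.
  by rewrite mem_index_iota.
by rewrite mem_index_iota => /= lt_cq ->; rewrite dvdn_mulr // ltn_pmul2l.
Qed.

(** Multiplication by a unit permutes the residues modulo [m]. *)
Lemma sum_mul_unit (V : nmodType) (m u : nat) (F : nat -> V) :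
  (0 < m)%N -> coprime u m -> periodic_mod m F ->
  \sum_(k < m) F (u * k)%N = \sum_(k < m) F k.
Proof.
move=> m_gt0 co_um perF.
pose f (k : 'I_m) := Ordinal (ltn_pmod (u * k) m_gt0).
have inj_f : injective f.
  move=> a b /(congr1 val) /= /eqP; rewrite eqn_modMl_coprime //.
  by rewrite !modn_small ?ltn_ord // => /eqP/val_inj.
rewrite [RHS](reindex f) /=; last by apply: onW_bij; apply: injF_bij.
by apply: eq_bigr => k _; rewrite perF.
Qed.

(** Modulo [m] only [n * a] survives, and [n] is a unit there; symmetrically modulo [n]. Hence the
    map on pairs is injective, and equal cardinalities make it bijective. *)
Lemma sum_crt (V : nmodType) (m n : nat) (F : nat -> V) :
  (0 < m)%N -> (0 < n)%N -> coprime m n -> periodic_mod (m * n)%N F ->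
  \sum_(k < (m * n)%N) F k = \sum_(a < m) \sum_(b < n) F (n * a + m * b)%N.
Proof.
move=> m_gt0 n_gt0 co_mn perF.
have mn_gt0 : (0 < m * n)%N by rewrite muln_gt0 m_gt0.
pose f (p : 'I_m * 'I_n) := Ordinal (ltn_pmod (n * p.1 + m * p.2) mn_gt0).
have inj_f : injective f.
  move=> [a b] [a' b'] /(congr1 val) /= /eqP; rewrite chinese_remainder //.
  rewrite -(modnDmr (n * a)) -(modnDmr (n * a')) !modnMr !addn0.
  rewrite -(modnDml (n * a)) -(modnDml (n * a')) !modnMr !add0n.
  have co_nm : coprime n m by rewrite coprime_sym.
  rewrite !eqn_modMl_coprime //.
  rewrite !modn_small ?ltn_ord // => /andP[/eqP eq_a /eqP eq_b].
  by congr (_, _); apply: val_inj.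
rewrite (reindex f) /=; last first.
  by apply: onW_bij; apply: inj_card_bij => //; rewrite card_prod !card_ord.
by rewrite pair_bigA; apply: eq_bigr => -[a b] _ /=; rewrite perF.
Qed.

(** At [n * a + m * b] the function [F] sees only [n * a] and [H] only [m * b]; the unit factors [n]
    and [m] are then absorbed by [sum_mul_unit]. *)
Lemma sum_crt_mul (A : pzSemiRingType) (m n : nat) (F H : nat -> A) :
  (0 < m)%N -> (0 < n)%N -> coprime m n ->
  periodic_mod m F -> periodic_mod n H ->
  \sum_(k < (m * n)%N) F k * H k = (\sum_(a < m) F a) * (\sum_(b < n) H b).
Proof.
move=> m_gt0 n_gt0 co_mn perF perH.
rewrite (@sum_crt _ m n (fun k => F k * H k)) //; last first.
  move=> k; rewrite -perF -perH modn_dvdm ?dvdn_mulr // modn_dvdm ?dvdn_mull //.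
  by rewrite perF perH.
have co_nm : coprime n m by rewrite coprime_sym.
rewrite -(sum_mul_unit m_gt0 co_nm perF).
rewrite -(sum_mul_unit n_gt0 co_mn perH).
rewrite big_distrl /=; apply: eq_bigr => a _.
rewrite big_distrr /=; apply: eq_bigr => b _; congr (_ * _).
  by apply: (periodic_mod_eq perF); rewrite -modnDmr modnMr addn0.
by apply: (periodic_mod_eq perH); rewrite -modnDml modnMr.
Qed.

(** Take [u] congruent to [x] modulo [d] and to [1] modulo the part of [m] prime to [d]. A prime
    factor of [m] either divides [d], hence not [u], or divides that other part, where [u] is
    [1]. *)
Lemma unit_lift (d m x : nat) :
  (0 < m)%N -> (d %| m)%N -> coprime x d ->
  exists2 u, coprime u m & u = x %[mod d].
Proof.
move=> m_gt0 dv_dm co_xd; have d_gt0 := dvdn_gt0 m_gt0 dv_dm.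
have co_dm' : coprime d m`_(\pi(d)^').
  by rewrite coprime_pi' ?part_gt0 // part_pnat.
have := @chinese_modl _ _ co_dm' x 1; have := @chinese_modr _ _ co_dm' x 1.
move: (chinese _ _ _ _) => u eq_u1 eq_ux; exists u => //.
have co_ud : coprime u d by rewrite -coprime_modl eq_ux coprime_modl.
rewrite -(partnC \pi(d) m_gt0) coprimeMr; apply/andP; split; last first.
  by rewrite -coprime_modl eq_u1 coprime_modl coprime1n.
(* The lift can be [0] only if [d = 1], and then the [\pi(d)]-part of [m] is [1]. *)
rewrite coprime_sym; case: (posnP u) co_ud => [-> | u_gt0 co_ud].
  by rewrite /coprime gcd0n gcdn0 => /eqP ->; rewrite /partn big_pred0.
apply: (pnat_coprime (pi := \pi(d))); first exact: part_pnat.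
by rewrite -coprime_pi' // coprime_sym.
Qed.

(** Multiplying by a lift [u] of the unit [x] carries the fibre over [1] onto the fibre over [x], so
    all fibres have the same size. That size stays an explicit count here, to be evaluated by taking
    [F] constant. *)
Lemma sum_units_reduce (A : pzSemiRingType) (d m : nat) (F : nat -> A) :
  (0 < m)%N -> (d %| m)%N -> periodic_mod d F ->
  \sum_(k < m | coprime k m) F k =
    (\sum_(k < m) (coprime k m && (k == 1 %[mod d])))%:R *
    \sum_(x < d | coprime x d) F x.
Proof.
move=> m_gt0 dv_dm perF; have d_gt0 := dvdn_gt0 m_gt0 dv_dm.
pose f (k : nat) := Ordinal (ltn_pmod k d_gt0).
rewrite (partition_big (f \o val) (fun x : 'I_d => coprime x d)) /=; last first.
  by move=> k; rewrite coprime_modl; apply: coprime_dvdr.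
rewrite big_distrr /=; apply: eq_bigr => x co_xd.
have [u co_um eq_ux] := unit_lift m_gt0 dv_dm co_xd.
rewrite (eq_bigr (fun _ => 1 * F x)); last first.
  by move=> k /andP[_ /eqP<-] /=; rewrite perF mul1r.
rewrite -big_distrl /=; congr (_ * _); rewrite natr_sum big_mkcond /=.
pose H k : A := (coprime k m && (k == x %[mod d]))%:R.
have perH : periodic_mod m H.
  by move=> k; rewrite /H coprime_modl modn_dvdm.
transitivity (\sum_(k < m) H k).
  apply: eq_bigr => k _; rewrite /H -val_eqE /=.
  by rewrite [(x %% d)%N]modn_small ?ltn_ord //; case: ifP.
rewrite -(sum_mul_unit m_gt0 co_um perH); apply: eq_bigr => k _.
rewrite /H coprimeMl co_um /= -eq_ux -{2}(muln1 u) eqn_modMl_coprime //.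
exact: coprime_dvdr co_um.
Qed.

(** * The Moebius function *)

(** If [p] divides [d], its exponent in [p * d] is at least 2; otherwise [p] is one more simple
    prime factor. The vanishing of the divisor sums of [moebius] rests on this recursion. *)
Lemma moebius_mul_prime (p d : nat) :
  prime p -> (0 < d)%N ->
  moebius (p * d) = if (p %| d)%N then 0 else - moebius d.
Proof.
move=> pr_p d_gt0; have p_gt0 := prime_gt0 pr_p.
have pd_gt0 : (0 < p * d)%N by rewrite muln_gt0 p_gt0.
rewrite /moebius; case: (boolP (p %| d)%N) => [dv_pd | ndv_pd].
  case: ifP => // /allP all1.
 have := all1 p; rewrite mem_primes pr_p pd_gt0 dvdn_mulr //.
  move=> /(_ isT); rewrite lognM // logn_prime // eqxx add1n eqSS.
  by rewrite -leqn0 leqNgt logn_gt0 mem_primes pr_p d_gt0 dv_pd.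
have p_notin : p \notin primes d by rewrite mem_primes (negPf ndv_pd) !andbF.
have perm_pd : perm_eq (primes (p * d)) (p :: primes d).
  apply: uniq_perm; rewrite /= ?p_notin ?primes_uniq // => q.
  by rewrite primesM // primes_prime // !inE.
rewrite (perm_all _ perm_pd) (perm_size perm_pd) /=.
have -> : logn p (p * d) == 1%N.
  by rewrite lognM // logn_prime // eqxx (lognE p d) (negPf ndv_pd) !andbF.
have -> : all (fun q => logn q (p * d) == 1%N) (primes d) =
          all (fun q => logn q d == 1%N) (primes d).
  apply: eq_in_all => q q_d; rewrite lognM // logn_prime //.
  by case: (q =P p) q_d p_notin => [-> -> |].
by case: (all _ _) => /=; rewrite ?oppr0 // exprS mulN1r.
Qed.

Lemma sum_divisors_mul (V : nmodType) (p q : nat) (F : nat -> V) :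
  (0 < p)%N -> (0 < q)%N ->
  \sum_(d <- divisors (p * q) | (p %| d)%N) F d =
  \sum_(d <- divisors q) F (p * d)%N.
Proof.
move=> p_gt0 q_gt0.
rewrite -[RHS](big_map (muln p) xpredT F) -[LHS]big_filter; apply: perm_big.
apply: uniq_perm.
- by rewrite filter_uniq ?divisors_uniq.
- rewrite map_inj_uniq ?divisors_uniq // => a b /eqP.
  by rewrite eqn_pmul2l // => /eqP.
move=> d; rewrite mem_filter -dvdn_divisors ?muln_gt0 ?p_gt0 //.
apply/andP/mapP => [[/dvdnP[c ->]] | [c]].
  rewrite mulnC dvdn_pmul2l // => dv_cq; exists c => //.
  by rewrite -dvdn_divisors.
by rewrite -dvdn_divisors // => dv_cq ->; rewrite dvdn_mulr // dvdn_pmul2l.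
Qed.

Lemma sum_divisors_div (V : nmodType) (n : nat) (F : nat -> V) :
  (0 < n)%N ->
  \sum_(d <- divisors n) F (n %/ d)%N = \sum_(d <- divisors n) F d.
Proof.
move=> n_gt0.
have divK d : (d %| n)%N -> (n %/ (n %/ d) = d)%N.
  by move=> dv_dn; rewrite divnA ?mulKn.
rewrite -(big_map (divn n) xpredT F); apply: perm_big; apply: uniq_perm.
- rewrite map_inj_in_uniq ?divisors_uniq // => a b.
  by rewrite -!dvdn_divisors // => /divK {2}<- /divK {2}<- ->.
- exact: divisors_uniq.
move=> d; rewrite -dvdn_divisors //; apply/mapP/idP => [[c] | dv_d].
  by rewrite -dvdn_divisors // => dv_c ->; rewrite dvdn_div.
by exists (n %/ d)%N; rewrite ?divK // -dvdn_divisors // dvdn_div.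
Qed.

(** Write [n = p * q] with [p] prime. The divisors of [n] that are multiples of [p] are the [p * d]
    with [d] dividing [q], and they contribute only when [p] does not divide [d]. The other divisors
    of [n] are exactly these [d], and the terms at [d] and [p * d] cancel. *)
Lemma sum_moebius (n : nat) :
  (0 < n)%N -> \sum_(d <- divisors n) moebius d = (n == 1%N)%:R.
Proof.
case: (ltngtP n 1) => [|n_gt1 _|-> _] //=.
  have [p pr_p /dvdnP[q]] : exists2 p, prime p & (p %| n)%N.
    by exists (pdiv n); rewrite ?pdiv_prime ?pdiv_dvd.
  have p_gt0 := prime_gt0 pr_p; rewrite mulnC => def_n.
  move: (ltnW n_gt1); rewrite {n n_gt1}def_n muln_gt0 => /andP[_ q_gt0].
  rewrite (bigID (fun d => p %| d)%N) /= sum_divisors_mul //.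
  rewrite (bigID (fun d => p %| d)%N) /= big_seq_cond big1 => [|d]; last first.
    rewrite -dvdn_divisors // => /andP[/(dvdn_gt0 q_gt0) d_gt0 dv_pd].
    by rewrite moebius_mul_prime // dv_pd.
  rewrite add0r.
  have -> : \sum_(d <- divisors (p * q) | ~~ (p %| d)%N) moebius d =
            \sum_(d <- divisors q | ~~ (p %| d)%N) moebius d.
    rewrite -big_filter -[RHS]big_filter; apply: perm_big; apply: uniq_perm.
    - by rewrite filter_uniq ?divisors_uniq.
    - by rewrite filter_uniq ?divisors_uniq.
    move=> d; rewrite !mem_filter -!dvdn_divisors ?muln_gt0 ?p_gt0 //.
    case: (boolP (p %| d)%N) => //= ndv_pd.
    by rewrite Gauss_dvdr // coprime_sym prime_coprime.
  rewrite -big_split big_seq_cond big1 //= => d.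
  rewrite -dvdn_divisors // => /andP[/(dvdn_gt0 q_gt0) d_gt0 ndv_pd].
  by rewrite moebius_mul_prime // (negPf ndv_pd) addNr.
by rewrite big_seq1.
Qed.

(** * Roots of unity *)

Definition root_exp (R : realType) (n : nat) (x : int) : R[i] :=
  cexp (2 * (pi : R)%:C * 'i * x%:~R / n%:R).

Lemma root_expE (R : realType) n x :
  root_exp R n x = let t := 2 * pi * x%:~R / n%:R in cos t +i* sin t.
Proof.
rewrite /root_exp /cexp.
(* The exponent is ['i] times a real number, so its real part is zero and the factor [expR] becomes
   1. *)
have -> : 2 * (pi : R)%:C * 'i * x%:~R / n%:R = 'i * (2 * pi * x%:~R / n%:R)%:C.
  rewrite (rmorphM (real_complex R)) /=.
  rewrite (rmorphM (real_complex R)) /=.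
  rewrite (rmorphM (real_complex R)) /=.
  rewrite (fmorphV (real_complex R)) /= (rmorph_nat (real_complex R)).
  rewrite (rmorph_nat (real_complex R)) (rmorph_int (real_complex R)).
  by rewrite [_ * 'i]mulrC -!mulrA.
by rewrite -complexiE /= !mul0r !mul1r subrr add0r expR0 mul1r.
Qed.

Lemma root_expD (R : realType) n x y :
  root_exp R n (x + y) = root_exp R n x * root_exp R n y.
Proof.
rewrite !root_expE /= rmorphD /= mulrDr mulrDl cosD sinD.
by rewrite /GRing.mul /= [_ + cos _ * sin _]addrC.
Qed.

Lemma root_exp0 (R : realType) n : root_exp R n 0 = 1.
Proof. by rewrite root_expE /= !(mulr0, mul0r) cos0 sin0. Qed.

Lemma root_exp_mull (R : realType) m n x :
  (0 < m)%N -> root_exp R (m * n) (m%:Z * x) = root_exp R n x.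
Proof.
move=> m_gt0; rewrite !root_expE natrM rmorphM /= -pmulrn.
suff -> : 2 * pi * (m%:R * x%:~R) / (m%:R * n%:R) =
          2 * pi * x%:~R / n%:R :> R by [].
by rewrite mulrCA -mulf_div divff ?mul1r // pnatr_eq0 -lt0n.
Qed.

Lemma root_exp_nat_period (R : realType) n k :
  (0 < n)%N -> root_exp R n (n%:Z * k%:Z) = 1.
Proof.
move=> n_gt0; elim: k => [|k IHk]; first by rewrite mulr0 root_exp0.
rewrite -addn1 PoszD mulrDr root_expD IHk mul1r mulr1 root_expE /= -pmulrn.
by rewrite mulfK ?pnatr_eq0 -?lt0n // mulr_natl cos2pi sin2pi.
Qed.

Lemma root_exp_period (R : realType) n x :
  (0 < n)%N -> (n%:Z %| x)%Z -> root_exp R n x = 1.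
Proof.
move=> n_gt0 /dvdzP[k ->]; rewrite mulrC.
case: k => k; first exact: root_exp_nat_period.
(* A negative multiple is compared with its opposite, whose value is already known to be 1. *)
rewrite NegzE mulrN; apply: (@mulIf _ (root_exp R n (n%:Z * k.+1%:Z))).
  by rewrite root_exp_nat_period // oner_eq0.
by rewrite -root_expD addNr root_exp0 root_exp_nat_period // mul1r.
Qed.

Lemma root_exp_eq_mod (R : realType) n x y :
  (0 < n)%N -> (x == y %[mod n%:Z])%Z -> root_exp R n x = root_exp R n y.
Proof.
rewrite eqz_mod_dvd => n_gt0 dv_xy.
by rewrite -(subrK y x) root_expD root_exp_period // mul1r.
Qed.

Lemma root_exp_eq1 (R : realType) n x :
  (0 < n)%N -> (root_exp R n x == 1) = (n%:Z %| x)%Z.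
Proof.
move=> n_gt0; apply/eqP/idP; last exact: root_exp_period.
have nz_n : n%:Z != 0 by rewrite eqz_nat -lt0n.
rewrite (@root_exp_eq_mod _ _ _ (x %% n%:Z)%Z) ?modz_mod //.
have := modz_ge0 x nz_n; have := ltz_pmod x (n_gt0 : (0 < n%:Z)).
move=> lt_xn ge_x0 e1; apply/dvdz_mod0P; move: lt_xn ge_x0 e1.
case: (x %% n%:Z)%Z => // -[//|r]; rewrite ltz_nat => lt_rn _.
rewrite root_expE /= -pmulrn => -[+ _].
(* Passing to the half angle [t], which lies strictly between 0 and [pi], makes [sin t] positive,
   whereas [cos (2 t) = 1] forces [sin t ^+ 2 = 0]. *)
have -> : 2 * pi * r.+1%:R / n%:R = (pi * (r.+1%:R / n%:R)) *+ 2 :> R.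
  by rewrite -mulr_natl; ring.
set t := pi * _; rewrite cos_mulr2n => cos1.
have t_pi : 0 < t < pi.
  have n_gt0' : (0 : R) < n%:R by rewrite ltr0n.
  rewrite mulr_gt0 ?pi_gt0 ?divr_gt0 ?ltr0n //=.
  by rewrite gtr_pMr ?pi_gt0 // ltr_pdivrMr // mul1r ltr_nat.
have := sin_gt0_pi t_pi; have := cos2Dsin2 t => cs s_gt0.
have : 0 < sin t ^+ 2 by rewrite exprn_gt0.
have {}cos1 : cos t ^+ 2 *+ 2 - 1 = 1 := cos1.
move=> s2_gt0; exfalso; lra.
Qed.

Lemma sum_root_exp (R : realType) n k :
  (0 < n)%N ->
  \sum_(j < n) root_exp R n (j%:Z * k) =
  if (n%:Z %| k)%Z then n%:R else 0.
Proof.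
move=> n_gt0.
have expE j : root_exp R n (j%:Z * k) = root_exp R n k ^+ j.
  elim: j => [|j IHj]; first by rewrite mul0r root_exp0.
  by rewrite -addn1 PoszD mulrDl mul1r root_expD IHj addn1 exprSr.
under eq_bigr do rewrite expE.
case: ifPn => [dv_nk | ndv_nk].
  rewrite root_exp_period //; under eq_bigr do rewrite expr1n.
  by rewrite sumr_const card_ord.
(* Geometric sum: multiplied by the nonzero number [root_exp R n k - 1], it telescopes to the [n]-th
   power minus 1, which is zero. *)
have nz : root_exp R n k - 1 != 0 by rewrite subr_eq0 root_exp_eq1.
apply: (mulfI nz); rewrite mulr0 -subrX1 -expE root_exp_period ?subrr //.
exact: dvdz_mulr.
Qed.

(** * Ramanujan sums *)

(** The index [j = n] is traded for [j = 0]; this matters only for [n = 1], where it is the sole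
    term. *)
Lemma ramanujan_sumE (R : realType) n k : (0 < n)%N ->
  ramanujan_sum R n k = \sum_(j < n | coprime j n) root_exp R n (j%:Z * k).
Proof.
move=> n_gt0; rewrite /ramanujan_sum.
rewrite (eq_bigr (fun j : nat => root_exp R n (j%:Z * k))); last first.
  by move=> j _; rewrite /root_exp rmorphM /= -pmulrn !mulrA.
rewrite big_mkcond [RHS]big_mkcond /=.
pose F j := if coprime j n then root_exp R n (j%:Z * k) else 0.
apply: (@sum_shift_period _ n F n_gt0) => j; rewrite /F coprime_modl.
case: ifP => // _; apply: root_exp_eq_mod => //.
by rewrite -modz_nat modzMml.
Qed.

Lemma ramanujan_sum_eq_mod (R : realType) n x y :
  (0 < n)%N -> (x == y %[mod n%:Z])%Z ->
  ramanujan_sum R n x = ramanujan_sum R n y.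
Proof.
move=> n_gt0 /eqP eq_xy; rewrite !ramanujan_sumE //; apply: eq_bigr => j _.
by apply: root_exp_eq_mod => //; rewrite -modzMmr eq_xy modzMmr.
Qed.

Lemma coprime_crt m n a b :
  coprime m n -> coprime (n * a + m * b) (m * n) = coprime a m && coprime b n.
Proof.
move=> co_mn; have co_nm : coprime n m by rewrite coprime_sym.
rewrite coprimeMr -[in X in X && _]coprime_modl -[in X in _ && X]coprime_modl.
rewrite -(modnDmr (n * a)) modnMr addn0 -(modnDml (n * a)) modnMr add0n.
by rewrite !coprime_modl !coprimeMl co_mn co_nm.
Qed.

Lemma ramanujan_sumM (R : realType) m n k :
  (0 < m)%N -> (0 < n)%N -> coprime m n ->
  ramanujan_sum R (m * n) k = ramanujan_sum R m k * ramanujan_sum R n k.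
Proof.
move=> m_gt0 n_gt0 co_mn; have mn_gt0 : (0 < m * n)%N by rewrite muln_gt0 m_gt0.
rewrite !ramanujan_sumE // !(big_mkcond (fun i => coprime (nat_of_ord i) _)) /=.
pose F j := if coprime j (m * n) then root_exp R (m * n) (j%:Z * k) else 0.
rewrite (@sum_crt _ m n F) //; last first.
  move=> j; rewrite /F coprime_modl; case: ifP => // _.
  by apply: root_exp_eq_mod => //; rewrite -modz_nat modzMml.
rewrite big_distrl /=; apply: eq_bigr => a _.
rewrite big_distrr /=; apply: eq_bigr => b _.
rewrite /F coprime_crt //; case: (coprime a m); last by rewrite mul0r.
case: (coprime b n); last by rewrite mulr0.
(* This is the identity [(n a + m b) / (m n) = a / m + b / n] inside the exponential. *)
rewrite /= PoszD !PoszM mulrDl root_expD -(mulrA n%:Z) -(mulrA m%:Z).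
rewrite root_exp_mull //.
by rewrite (mulnC m n) root_exp_mull.
Qed.

Lemma ramanujan_sum_divisors (R : realType) n k : (0 < n)%N ->
  ramanujan_sum R n k =
    \sum_(d <- divisors n | (d%:Z %| k)%Z) d%:R * (moebius (n %/ d))%:~R.
Proof.
move=> n_gt0; rewrite ramanujan_sumE // big_mkcond /=.
transitivity (\sum_(j < n) \sum_(d <- divisors n | (d %| j)%N)
                 (moebius d)%:~R * root_exp R n (j%:Z * k)).
  apply: eq_bigr => j _; rewrite -big_distrl /= -rmorph_sum /=.
  (* The divisors of [n] that divide [j] are the divisors of [gcdn j n]. *)
  have -> : \sum_(d <- divisors n | (d %| j)%N) moebius d = (coprime j n)%:R.
    have g_gt0 : (0 < gcdn j n)%N by rewrite gcdn_gt0 n_gt0 orbT.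
    rewrite /coprime -sum_moebius // -big_filter; apply: perm_big.
    apply: uniq_perm; rewrite ?filter_uniq ?divisors_uniq // => d.
    by rewrite mem_filter -!dvdn_divisors // dvdn_gcd.
  by case: (coprime j n); rewrite ?mul1r ?mul0r.
rewrite (exchange_big_dep xpredT) //= [RHS]big_mkcond /=.
(* The multiples [j] of [d] give a full sum of roots of unity of order [n / d], so the term at [d]
   on the left matches the one at the complementary divisor on the right. *)
rewrite -[RHS]sum_divisors_div // big_seq [RHS]big_seq.
apply: eq_bigr => d; rewrite -dvdn_divisors // => /dvdnP[q def_n].
move: n_gt0; rewrite {n}def_n mulnC muln_gt0 => /andP[d_gt0 q_gt0].
rewrite -big_distrr /=.
rewrite (@sum_multiples _ d q (fun j => root_exp R (d * q) (j%:Z * k))) //.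
under eq_bigr do rewrite PoszM -(mulrA d%:Z) root_exp_mull //.
rewrite sum_root_exp // mulKn // mulnK //.
by case: ifP; rewrite ?mulr0 // mulrC.
Qed.

(** * Sums over polynomial values *)

(** As [y] is a root of [g - g(y)], the factor theorem makes [x - y] divide [g(x) - g(y)]. *)
Lemma horner_eq_mod (g : {poly int}) (d x y : int) :
  (x == y %[mod d])%Z -> (g.[x] == g.[y] %[mod d])%Z.
Proof.
rewrite !eqz_mod_dvd => dv_xy.
have /factor_theorem[q gq] : root (g - (g.[y])%:P) y.
  by rewrite /root !hornerE subrr.
have := congr1 (horner^~ x) gq; rewrite !hornerE => ->.
exact: dvdz_mull.
Qed.

Lemma horner_modn (g : {poly int}) (d m k : nat) :
  (d %| m)%N -> (g.[(k %% m)%N%:Z] == g.[k%:Z] %[mod d%:Z])%Z.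
Proof. by move=> dv_dm; apply: horner_eq_mod; rewrite !modz_nat modn_dvdm. Qed.

Lemma ramanujan_sum_horner_periodic (R : realType) (g : {poly int})
    (d m : nat) :
  (0 < d)%N -> (d %| m)%N ->
  periodic_mod m (fun k => ramanujan_sum R d g.[k%:Z]).
Proof.
by move=> d_gt0 dv_dm k; apply: ramanujan_sum_eq_mod => //; apply: horner_modn.
Qed.

(** * Multiplicativity of the sum over a system *)

Lemma lcm_tuple_gt0 r (m : 'I_r -> nat) :
  (forall i, 0 < m i)%N -> (0 < lcm_tuple m)%N.
Proof.
move=> m_gt0; rewrite /lcm_tuple.
by apply: (big_ind (fun x => 0 < x)%N) => // x y; rewrite lcmn_gt0 => -> ->.
Qed.

Lemma dvdn_lcm_tuple r (m : 'I_r -> nat) i : (m i %| lcm_tuple m)%N.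
Proof. exact: (biglcmn_sup i). Qed.

Lemma lcm_tuple_dvd_prod r (m : 'I_r -> nat) :
  (lcm_tuple m %| \prod_(i < r) m i)%N.
Proof. by apply/dvdn_biglcmP => i _; rewrite (bigD1 i) //= dvdn_mulr. Qed.

Lemma lcm_tuple_coprime r (m n : 'I_r -> nat) :
  coprime (\prod_(i < r) m i) (\prod_(i < r) n i) ->
  coprime (lcm_tuple m) (lcm_tuple n).
Proof.
by move=> co; apply: coprime_dvdl (lcm_tuple_dvd_prod m) _;
   apply: coprime_dvdr (lcm_tuple_dvd_prod n) co.
Qed.

Lemma lcm_tupleM r (m n : 'I_r -> nat) :
  coprime (lcm_tuple m) (lcm_tuple n) ->
  lcm_tuple (fun i => m i * n i)%N = (lcm_tuple m * lcm_tuple n)%N.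
Proof.
move=> co_mn; apply/eqP; rewrite eqn_dvd; apply/andP; split.
  by apply/dvdn_biglcmP => i _; apply: dvdn_mul; apply: dvdn_lcm_tuple.
rewrite Gauss_dvd //; apply/andP; split; apply/dvdn_biglcmP => i _.
  by apply: dvdn_trans (dvdn_lcm_tuple _ i); rewrite dvdn_mulr.
by apply: dvdn_trans (dvdn_lcm_tuple _ i); rewrite dvdn_mull.
Qed.

Lemma R_sysE (R : realType) r (G : 'I_r -> {poly int}) (m : 'I_r -> nat) :
  (forall i, 0 < m i)%N ->
  R_sys R G m = \sum_(k < lcm_tuple m | coprime k (lcm_tuple m))
     \prod_(i < r) ramanujan_sum R (m i) (G i).[k%:Z].
Proof.
move=> m_gt0.
apply: (@sum_coprime_shift _ _ (fun k =>
  \prod_i ramanujan_sum R (m i) (G i).[k%:Z])).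
  exact: lcm_tuple_gt0.
move=> k; apply: eq_bigr => i _.
by rewrite (ramanujan_sum_horner_periodic _ _ _ (dvdn_lcm_tuple m i)).
Qed.

Lemma R_sysM (R : realType) r (G : 'I_r -> {poly int}) (m n : 'I_r -> nat) :
  (forall i, 0 < m i)%N -> (forall i, 0 < n i)%N ->
  coprime (\prod_(i < r) m i) (\prod_(i < r) n i) ->
  R_sys R G (fun i => m i * n i)%N = R_sys R G m * R_sys R G n.
Proof.
move=> m_gt0 n_gt0 /lcm_tuple_coprime co_mn.
rewrite !R_sysE // => [|i]; last by rewrite muln_gt0 m_gt0 n_gt0.
rewrite lcm_tupleM //.
have co_i i : coprime (m i) (n i).
  apply: coprime_dvdl (dvdn_lcm_tuple m i) _.
  exact: coprime_dvdr (dvdn_lcm_tuple n i) co_mn.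
(* Extended by zero off the units, the summand for [m * n] is the product of those for [m] and [n],
   coprimality condition included. *)
pose H (l : 'I_r -> nat) k := if coprime k (lcm_tuple l) then
  \prod_(i < r) ramanujan_sum R (l i) (G i).[k%:Z] else 0.
have perH l : (forall i, 0 < l i)%N -> periodic_mod (lcm_tuple l) (H l).
  move=> l_gt0 k; rewrite /H coprime_modl; case: ifP => // _.
  apply: eq_bigr => i _.
  by rewrite (ramanujan_sum_horner_periodic _ _ _ (dvdn_lcm_tuple l i)).
rewrite !(big_mkcond (fun k => coprime (nat_of_ord k) _)) /=.
have M_gt0 := lcm_tuple_gt0 m_gt0; have N_gt0 := lcm_tuple_gt0 n_gt0.
have := sum_crt_mul M_gt0 N_gt0 co_mn (perH m m_gt0) (perH n n_gt0).
rewrite /H => <-; apply: eq_bigr => k _; rewrite coprimeMr.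
case: (coprime k (lcm_tuple m)); last by rewrite mul0r.
case: (coprime k (lcm_tuple n)); last by rewrite mulr0.
by rewrite /= -big_split; apply: eq_bigr => i _; rewrite ramanujan_sumM.
Qed.

Lemma ramanujan_sum1 (R : realType) k : ramanujan_sum R 1 k = 1.
Proof.
by rewrite ramanujan_sumE // big_mkcond big_ord1 /= mul0r root_exp0.
Qed.

(** Provides the nonzero value that [multiplicative_fun] asks for. *)
Lemma R_sys1 (R : realType) r (G : 'I_r -> {poly int}) :
  R_sys R G (fun _ => 1%N) = 1.
Proof.
have lcm1 : lcm_tuple (fun _ : 'I_r => 1%N) = 1%N by rewrite /lcm_tuple big1.
rewrite /R_sys lcm1 big_mkcond big_nat1 /= big1 // => i _.
exact: ramanujan_sum1.
Qed.

(** * The closed formula in one variable *)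

Lemma totient_sum (A : pzSemiRingType) n :
  (totient n)%:R = \sum_(k < n | coprime k n) 1 :> A.
Proof.
rewrite totient_count_coprime big_mkord natr_sum [RHS]big_mkcond /=.
by apply: eq_bigr => k _; rewrite coprime_sym; case: coprime.
Qed.

Lemma sum_units_eta (R : realType) (g : {poly int}) (d m : nat) :
  (0 < m)%N -> (d %| m)%N ->
  \sum_(k < m | coprime k m) ((d%:Z %| g.[k%:Z])%Z)%:R =
    (totient m)%:R / (totient d)%:R * (eta g d)%:R :> R[i].
Proof.
move=> m_gt0 dv_dm; have d_gt0 := dvdn_gt0 m_gt0 dv_dm.
(* The constant function 1 evaluates the fibre size of the reduction of units as
   [totient m / totient d]. *)
have per1 : periodic_mod d (fun _ => 1 : R[i]) by [].
rewrite (totient_sum _ m) (sum_units_reduce m_gt0 dv_dm per1) -totient_sum.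
rewrite mulfK; last by rewrite pnatr_eq0 -lt0n totient_gt0.
have perg : periodic_mod d (fun k => ((d%:Z %| g.[k%:Z])%Z)%:R : R[i]).
  move=> k; have /eqP eqg := horner_modn g k (dvdnn d).
  by congr (nat_of_bool _)%:R; apply/dvdz_mod0P/dvdz_mod0P; rewrite eqg.
rewrite (sum_units_reduce m_gt0 dv_dm perg); congr (_ * _).
rewrite /eta -sum1_card natr_sum big_mkcond [RHS]big_mkcond /=.
by apply: eq_bigr => x _; rewrite inE; case: (coprime x d); case: (_ %| _)%Z.
Qed.

Lemma sum_ramanujan_eta (R : realType) (g : {poly int}) m : (0 < m)%N ->
  \sum_(1 <= k < m.+1 | coprime k m) ramanujan_sum R m g.[k%:Z] =
    (totient m)%:R *
    \sum_(d <- divisors m)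
       d%:R * (moebius (m %/ d))%:~R / (totient d)%:R * (eta g d)%:R.
Proof.
have perg m_gt0 := @ramanujan_sum_horner_periodic R g m m m_gt0 (dvdnn m).
move=> m_gt0; rewrite (sum_coprime_shift m_gt0 (perg m_gt0)).
under eq_bigr => k _ do rewrite ramanujan_sum_divisors // big_mkcond /=.
rewrite exchange_big /= big_distrr /= big_seq [RHS]big_seq.
apply: eq_bigr => d; rewrite -dvdn_divisors // => dv_dm.
rewrite (eq_bigr (fun k : 'I_m =>
  d%:R * (moebius (m %/ d))%:~R * ((d%:Z %| g.[k%:Z])%Z)%:R)); last first.
  by move=> k _; case: ifP; rewrite ?mulr0 ?mulr1.
rewrite -big_distrr /= sum_units_eta //.
by rewrite !mulrA; congr (_ / _ * _); ring.
Qed.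

Theorem corollary6 (R : realType) :
  (forall (r : nat) (G : 'I_r -> {poly int}), (0 < r)%N ->
     multiplicative_fun (fun m : 'I_r -> nat => R_sys R G m)) /\
  (forall g : {poly int},
     (forall m : nat, (0 < m)%N ->
        R_one R g m =
          \sum_(1 <= k < m.+1 | coprime k m) ramanujan_sum R m g.[k%:Z] /\
        \sum_(1 <= k < m.+1 | coprime k m) ramanujan_sum R m g.[k%:Z] =
          (totient m)%:R *
          \sum_(d <- divisors m)
             d%:R * (moebius (m %/ d))%:~R / (totient d)%:R * (eta g d)%:R
          :> R[i]) /\
     multiplicative_fun1 (fun m : nat => R_one R g m)).
Proof.
split=> [r G _ | g]; last split=> [m m_gt0 | ].
- split=> [|m n m_gt0 n_gt0 co_mn]; last exact: R_sysM.
  by exists (fun=> 1%N) => //; rewrite R_sys1; apply/eqP/oner_neq0.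
- split; last exact: sum_ramanujan_eta.
  rewrite /R_one /R_sys /lcm_tuple big_ord1.
  by apply: eq_bigr => k _; rewrite big_ord1.
- split=> [|m n m_gt0 n_gt0 co_mn].
    by exists (fun=> 1%N) => //; rewrite /R_one R_sys1; apply/eqP/oner_neq0.
  (* [R_one] works with constant tuples, so [m] and [n] enter through their only value, and the
     products in the coprimality hypothesis have a single factor. *)
  apply: (@R_sysM R 1 (fun=> g) (fun=> m ord0) (fun=> n ord0)) => //.
  by rewrite !big_ord1 in co_mn *.
Qed.
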